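(* Let $n\ge 3$ and let $SG_n'$ denote the commutator subgroup of the singular braid group $SG_n$. Then: (i) $SG_n'$ is finitely generated for all $n\ge 5$. Further, for $n\ge 5$, the rank of $SG_n'$ is at most $2n-4$. (ii) $SG_3'$ and $SG_4'$ are not finitely generated. (iii) $SG_n'$ is perfect if and only if $n\ge 5$.
   Context: For $n\ge 3$, the singular braid group $SG_n$ is the group with $2(n-1)$ generators $\sigma_i,\rho_i$ ($1\le i\le n-1$) and the following defining relations (for all indices for which they make sense, i.e. all indices lie in $\{1,\dots,n-1\}$): $\sigma_i\sigma_j=\sigma_j\sigma_i$ if $|i-j|>1$; $\sigma_i\sigma_{i+1}\sigma_i=\sigma_{i+1}\sigma_i\sigma_{i+1}$; $\rho_i\rho_j=\rho_j\rho_i$ if $|i-j|>1$; $\rho_i\sigma_{i+1}\sigma_i=\sigma_{i+1}\sigma_i\rho_{i+1}$; $\rho_{i+1}\sigma_i\sigma_{i+1}=\sigma_i\sigma_{i+1}\rho_i$; $\sigma_i\rho_j=\rho_j\sigma_i$ if $i=j$ or $|i-j|>1$. For a group $G$, $G'=[G,G]$ is the commutator subgroup, generated by all $x^{-1}y^{-1}xy$ with $x,y\in G$. A group $H$ is perfect if $H=H'$. The rank of a finitely generated group is the minimal cardinality of a generating set. *)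

(* Defs.v *)
From HB Require Import structures.
From mathcomp Require Import all_boot.
From mathcomp Require Import all_classical.

Set Implicit Arguments.
Unset Strict Implicit.
Unset Printing Implicit Defensive.

Local Open Scope quotient_scope.
Local Open Scope classical_set_scope.
Local Open Scope card_scope.
Local Open Scope group_scope.

Section Presentation.
Variable X : choiceType.

(* A word is a product of letters: (x, false) is the generator x and
   (x, true) is its formal inverse; the product of words is concatenation. *)
Definition letter : Type := X * bool.
Definition word : Type := seq letter.

Definition inv_letter (a : letter) : letter := (a.1, ~~ a.2).
Definition inv_word (w : word) : word := rev (map inv_letter w).

Variable rel : word -> word -> Prop.

(* The least congruence on words that contains the relations u = v, for
   rel u v, and the free cancellations (both orders, as a is any letter). *)
Inductive pres_cong : word -> word -> Prop :=
| cong_refl u : pres_cong u u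
| cong_sym u v : pres_cong u v -> pres_cong v u
| cong_trans u v w : pres_cong u v -> pres_cong v w -> pres_cong u w
| cong_cat u u' v v' :
    pres_cong u u' -> pres_cong v v' -> pres_cong (u ++ v) (u' ++ v')
| cong_cancel a : pres_cong [:: a; inv_letter a] [::]
| cong_rel u v : rel u v -> pres_cong u v.

Definition pres_congb (u v : word) : bool := `[< pres_cong u v >].

Lemma pres_congb_refl : reflexive pres_congb.
Proof. by move=> u; apply/asboolP; exact: cong_refl. Qed.

Lemma pres_congb_sym : symmetric pres_congb.
Proof.
by move=> u v; apply/asboolP/asboolP; exact: cong_sym.
Qed.

Lemma pres_congb_trans : transitive pres_congb.
Proof.
by move=> v u w /asboolP uv /asboolP vw; apply/asboolP; exact: cong_trans uv vw.
Qed.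

Canonical pres_equiv :=
  EquivRel pres_congb pres_congb_refl pres_congb_sym pres_congb_trans.

Definition presented_group : Type := {eq_quot pres_equiv}.

HB.instance Definition _ := EqQuotient.on presented_group.
HB.instance Definition _ := Choice.on presented_group.

Lemma presented_eqP (u v : word) :
  \pi_presented_group u = \pi_presented_group v <-> pres_cong u v.
Proof.
by split=> [/eqquotP/asboolP|uv] //; apply/eqquotP/asboolP.
Qed.

Definition pres_one : presented_group := \pi_presented_group [::].
Definition pres_mul (g h : presented_group) : presented_group :=
  \pi_presented_group (repr g ++ repr h).
Definition pres_inv (g : presented_group) : presented_group :=
  \pi_presented_group (inv_word (repr g)).

Lemma cong_repr (u : word) : pres_cong (repr (\pi_presented_group u)) u.
Proof. by apply/presented_eqP; rewrite reprK. Qed.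

Lemma inv_letterK : involutive inv_letter.
Proof. by case=> x b; rewrite /inv_letter /= negbK. Qed.

Lemma inv_wordK : involutive inv_word.
Proof.
by move=> w; rewrite /inv_word map_rev revK (mapK inv_letterK).
Qed.

Lemma cong_mulV (w : word) : pres_cong (w ++ inv_word w) [::].
Proof.
elim: w => [|a w IH]; first exact: cong_refl.
have -> : (a :: w) ++ inv_word (a :: w) =
    [:: a] ++ (w ++ inv_word w) ++ [:: inv_letter a].
  by rewrite /inv_word map_cons rev_cons -cats1 /= !catA.
apply: cong_trans (cong_cancel a); apply: (cong_cat (cong_refl [:: a])).
exact: (cong_cat IH (cong_refl [:: inv_letter a])).
Qed.

Lemma cong_Vmul (w : word) : pres_cong (inv_word w ++ w) [::].
Proof. by rewrite -{2}(inv_wordK w); exact: cong_mulV. Qed.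

Lemma pi_mul (u v : word) :
  pres_mul (\pi_presented_group u) (\pi_presented_group v)
  = \pi_presented_group (u ++ v).
Proof. by apply/presented_eqP; apply: cong_cat; exact: cong_repr. Qed.

Lemma pres_mulA : associative pres_mul.
Proof.
move=> x y z; apply/presented_eqP.
apply: (cong_trans (cong_cat (cong_refl _) (cong_repr _))); rewrite catA.
exact: (cong_cat (cong_sym (cong_repr _)) (cong_refl _)).
Qed.

Lemma pres_mul1g : left_id pres_one pres_mul.
Proof. by move=> x; rewrite /pres_one -[x]reprK pi_mul. Qed.

Lemma pres_mulg1 : right_id pres_one pres_mul.
Proof. by move=> x; rewrite /pres_one -[x]reprK pi_mul cats0. Qed.

Lemma pres_mulVg : left_inverse pres_one pres_inv pres_mul.
Proof.
move=> x; rewrite /pres_inv -{2}[x]reprK pi_mul.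
by apply/presented_eqP; exact: cong_Vmul.
Qed.

Lemma pres_mulgV : right_inverse pres_one pres_inv pres_mul.
Proof.
move=> x; rewrite /pres_inv -{1}[x]reprK pi_mul.
by apply/presented_eqP; exact: cong_mulV.
Qed.

HB.instance Definition _ := isGroup.Build presented_group
  pres_mulA pres_mul1g pres_mulg1 pres_mulVg pres_mulgV.

End Presentation.

Section SubgroupNotions.
Variable G : groupType.

Definition is_subgroup (H : set G) : Prop :=
  [/\ H 1, (forall x y, H x -> H y -> H (x * y)) & (forall x, H x -> H x^-1)].

Definition generated (A : set G) : set G := smallest is_subgroup A.

(* [~ x, y] is x^-1 * (y^-1 * (x * y)). *)
Definition commutator_subgroup (H : set G) : set G :=
  generated [set [~ x, y] | x in H & y in H].

Definition perfect (H : set G) : Prop := H = commutator_subgroup H.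

Definition finitely_generated (H : set G) : Prop :=
  exists2 A : set G, finite_set A & generated A = H.

Definition has_rank (H : set G) (r : nat) : Prop :=
  (exists2 A : set G, A #= `I_r & generated A = H) /\
  (forall (A : set G) (k : nat), A #= `I_k -> generated A = H -> (r <= k)%N).

End SubgroupNotions.

Section SingularBraidGroup.
Variable n : nat.

(* The index i : 'I_n.-1 stands for i + 1 in {1, ..., n - 1}; inl i is the
   generator sigma_(i+1) and inr i is the generator rho_(i+1). *)
Definition SG_gen : Type := 'I_n.-1 + 'I_n.-1.

Definition sigma (i : 'I_n.-1) : word SG_gen := [:: (inl i : SG_gen, false)].
Definition rho (i : 'I_n.-1) : word SG_gen := [:: (inr i : SG_gen, false)].

(* |i - j| > 1 *)
Definition far (i j : 'I_n.-1) : bool := (i.+1 < j)%N || (j.+1 < i)%N.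

Inductive SG_rel : word SG_gen -> word SG_gen -> Prop :=
| SG_sigma_far (i j : 'I_n.-1) : far i j ->
    SG_rel (sigma i ++ sigma j) (sigma j ++ sigma i)
| SG_sigma_braid (i j : 'I_n.-1) : j = i.+1 :> nat ->
    SG_rel (sigma i ++ sigma j ++ sigma i) (sigma j ++ sigma i ++ sigma j)
| SG_rho_far (i j : 'I_n.-1) : far i j ->
    SG_rel (rho i ++ rho j) (rho j ++ rho i)
| SG_mixed_braid1 (i j : 'I_n.-1) : j = i.+1 :> nat ->
    SG_rel (rho i ++ sigma j ++ sigma i) (sigma j ++ sigma i ++ rho j)
| SG_mixed_braid2 (i j : 'I_n.-1) : j = i.+1 :> nat ->
    SG_rel (rho j ++ sigma i ++ sigma j) (sigma i ++ sigma j ++ rho i)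
| SG_mixed_comm (i j : 'I_n.-1) : (i == j) || far i j ->
    SG_rel (sigma i ++ rho j) (rho j ++ sigma i).

Definition SG : groupType := presented_group SG_rel.

Definition SG' : set SG := commutator_subgroup [set: SG].

End SingularBraidGroup.

Arguments SG' n : clear implicits.

(* Main.v *)
From HB Require Import structures.
Require Import Defs.
From mathcomp Require Import all_boot.
From mathcomp Require Import all_classical.
From mathcomp Require Import ssralg ssrnum ssrint zmodp ring zify.

(** For [n >= 5] let [H] be generated by the [2n - 4] elements [sigma_1^-1 sigma_i] and
[rho_1^-1 rho_i], [i > 1]. Each of them commutes with the first or with the fourth generator
of either kind, and all the [sigma_j] (all the [rho_j]) lie in one left and in one right
coset of [H]; hence [H] is normal, the quotient is abelian, and [H = SG'_n].  In the
quotient by the commutator subgroup of [SG'_n] the images of [sigma_4^-1 sigma_1] and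
[sigma_4^-1 sigma_2] commute, hence so do [sigma_1] and [sigma_2], and the braid relation
makes them equal; this propagates to all the generators, so the quotient is abelian.

For [n = 3, 4] there is a representation by affine maps of the space of sequences [int -> F_3],
with [t] the shift and [-1] a root modulo 3 of the Alexander polynomial [s^2 - s + 1] of
the trefoil: [sigma_i] has linear part [-1], [rho_i] has linear part [t], and their common
fixed point depends on the parity of [i]. The image of [SG'_n] is a nontrivial group of
translations, hence is abelian, and it contains translations by sequences with support
arbitrarily far to the right, hence is not finitely generated. *)

Set Implicit Arguments.
Unset Strict Implicit.
Unset Printing Implicit Defensive.

Local Open Scope quotient_scope.
Local Open Scope classical_set_scope.
Local Open Scope card_scope.
Local Open Scope group_scope.

(** * Normal subgroups, commutator subgroups and rank *)

Section Subgroups.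
Variable G : groupType.
Implicit Types (A H K : set G).

Definition is_normal H : Prop := is_subgroup H /\ forall x g, H x -> H (x ^ g).

Lemma generated_subgroup A : is_subgroup (generated A).
Proof.
split=> [K [[]]//|x y Ax Ay K KA|x Ax K KA]; have [[K1 KM KV] _] := KA.
  by apply: KM; [apply: Ax | apply: Ay].
by apply: KV; apply: Ax.
Qed.

Lemma generated_min A H : is_subgroup H -> A `<=` H -> generated A `<=` H.
Proof. exact: smallest_sub. Qed.

Lemma commutator_subgroup_min H K : is_subgroup K ->
    (forall x y, H x -> H y -> K [~ x, y]) -> commutator_subgroup H `<=` K.
Proof. by move=> sK HK; apply: generated_min => // _ [x Hx [y Hy <-]]; exact: HK. Qed.

Lemma mem_commutator H x y : H x -> H y -> commutator_subgroup H [~ x, y].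
Proof. by move=> Hx Hy; apply: sub_gen_smallest; exists x => //; exists y. Qed.

(** Both [s] and [s^-1] are tested, since conjugation by [s] alone could map the subgroup onto a
    proper part of itself. With this symmetry the admissible conjugators form the subgroup [N]. *)
Lemma generated_normal S A :
    generated S = [set: G] ->
    (forall s a, S s -> A a -> generated A (a ^ s) /\ generated A (a ^ s^-1)) ->
  is_normal (generated A).
Proof.
move=> genS SA; have [H1 HM HV] := generated_subgroup A.
split=> // x g Hx.
have extend h : (forall a, A a -> generated A (a ^ h)) ->
    forall y, generated A y -> generated A (y ^ h).
  move=> Ah; apply: generated_min => //; split=> [|u v Hu Hv|u Hu] /=.
  - by rewrite conj1g.
  - by rewrite conjMg; apply: HM.
  - by rewrite conjVg; apply: HV.
pose N := [set h | forall y, generated A y ->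
  generated A (y ^ h) /\ generated A (y ^ h^-1)].
suff /(_ g) : [set: G] `<=` N by move=> /(_ I)/(_ x Hx)[].
rewrite -genS; apply: generated_min.
  split=> [y Hy|u v Nu Nv y Hy|u Nu y /Nu[? ?]]; rewrite ?invg1 ?conjg1 ?invgK //.
  rewrite invgM !conjgM; split.
    by have [/Nv[]] := Nu _ Hy.
  by have [_ /Nu[]] := Nv _ Hy.
by move=> s Ss y Hy; split; apply: extend => // a Aa; have [] := SA s a Ss Aa.
Qed.

Lemma generatedT : generated [set: G] = [set: G].
Proof. by apply/seteqP; split=> // x _; apply: sub_gen_smallest. Qed.

Lemma commutator_subgroup_normal H : is_normal H -> is_normal (commutator_subgroup H).
Proof.
move=> [_ HJ]; apply: (generated_normal generatedT) => s _ _ [x Hx [y Hy <-]].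
by rewrite !conjRg; split; apply: mem_commutator; apply: HJ.
Qed.

Lemma commutator_subgroup_sub H : is_subgroup H -> commutator_subgroup H `<=` H.
Proof.
move=> sH; have [H1 HM HV] := sH; apply: commutator_subgroup_min => // x y Hx Hy.
exact: HM (HV _ Hx) (HM _ _ (HV _ Hy) (HM _ _ Hx Hy)).
Qed.

Lemma has_rank_le A H k : A #<= `I_k -> generated A = H ->
  exists2 r, has_rank H r & r <= k.
Proof.
move=> Ak AH.
have /finite_setP[j Aj] : finite_set A by apply/finite_set_leP; exists k.
pose P j := `[< exists2 B : set G, B #= `I_j & generated B = H >].
have exP : exists j, P j by exists j; apply/asboolP; exists A.
exists (ex_minn exP).
  case: ex_minnP => r /asboolP Pr minr; split=> // B i Bi BH.
  by apply: minr; apply/asboolP; exists B.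
case: ex_minnP => r _ minr; apply: leq_trans (minr j _) _.
  by apply/asboolP; exists A.
by rewrite -card_le_II -(card_le_eql Aj).
Qed.

End Subgroups.

(** * Generators and universal property of a presented group *)

Section PresentedGroups.
Variables (X : choiceType) (rel : word X -> word X -> Prop).
Local Notation P := (presented_group rel).

Definition gen (x : X) : P := \pi_P [:: (x, false)].

Lemma pi_cat (u v : word X) : \pi_P (u ++ v) = \pi_P u * \pi_P v.
Proof. by rewrite -pi_mul. Qed.

Lemma pi_inv_letter (a : letter X) : \pi_P [:: inv_letter a] = (\pi_P [:: a])^-1.
Proof.
apply/eqP; rewrite -mulg_eq1 -pi_cat; apply/eqP; apply/presented_eqP.
by rewrite -{2}[a]inv_letterK; apply: cong_cancel.
Qed.

Lemma pi_letter (a : letter X) : \pi_P [:: a] = if a.2 then (gen a.1)^-1 else gen a.1.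
Proof. by case: a => x [] //=; rewrite -pi_inv_letter. Qed.

Lemma generated_gen : generated (range gen) = [set: P].
Proof.
apply/seteqP; split=> // g _; rewrite -[g]reprK.
have [H1 HM HV] := generated_subgroup (range gen).
elim: (repr g) => [|a w IH]; first exact: H1.
rewrite -cat1s pi_cat; apply: HM => //; rewrite pi_letter.
have Ha : generated (range gen) (gen a.1) by apply: sub_gen_smallest; exists a.1.
by case: ifP => // _; apply: HV.
Qed.

Definition eval_word (T : groupType) (f : X -> T) (w : word X) : T :=
  foldr (fun a t => (if a.2 then (f a.1)^-1 else f a.1) * t) 1 w.

Lemma eval_word_cat (T : groupType) (f : X -> T) (u v : word X) :
  eval_word f (u ++ v) = eval_word f u * eval_word f v.
Proof. by elim: u => [|a u IH] /=; rewrite ?mul1g // IH mulgA. Qed.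

Lemma eval_word_cancel (T : groupType) (f : X -> T) (a : letter X) :
  eval_word f [:: a; inv_letter a] = 1.
Proof. by case: a => x []; rewrite /eval_word /= mulg1 ?mulVg ?mulgV. Qed.

(** Von Dyck's theorem: evaluation is constant on congruence classes, so it may be computed on the
    representative [repr g]. *)
Lemma presented_lift (T : groupType) (f : X -> T) :
    (forall u v, rel u v -> eval_word f u = eval_word f v) ->
  exists phi : UMagmaMorphism.type P T, forall x, phi (gen x) = f x.
Proof.
move=> frel.
have fcong u v : pres_cong rel u v -> eval_word f u = eval_word f v.
  elim=> // [? ? ? _ -> _ -> //|? ? ? ? _ IH1 _ IH2|a].
    by rewrite !eval_word_cat IH1 IH2.
  exact: eval_word_cancel.
pose phi (g : P) := eval_word f (repr g).
have phi_pi u : phi (\pi_P u) = eval_word f u by apply: fcong; apply: cong_repr.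
have phiM : {morph phi : g h / g * h}.
  by move=> g h; rewrite -[g]reprK -[h]reprK -pi_cat !phi_pi eval_word_cat.
have phi1 : phi 1 = 1 by rewrite [LHS]phi_pi.
pose m1 := isMultiplicative.Build P T phi phiM.
pose m2 := Multiplicative_isUMagmaMorphism.Build P T phi phi1.
pose phi' : UMagmaMorphism.type P T := HB.pack phi m1 m2.
exists phi' => x; rewrite /phi' /= phi_pi /=; exact: mulg1.
Qed.

End PresentedGroups.

(** * Quotients, kernels and commuting images *)

(** The quotient is presented by all elements of [G], with two words related when their values lie
    in the same left coset of [N]. Normality makes this relation a congruence, so the presentation
    adds no further identifications. *)
Lemma quotient_exists (G : groupType) (N : set G) : is_normal N ->
  exists (Q : groupType) (f : UMagmaMorphism.type G Q), forall x, f x = 1 <-> N x.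
Proof.
move=> [[N1 NM NV] NJ].
pose ev : word G -> G := eval_word id.
pose rel (u v : word G) := N ((ev u)^-1 * ev v).
have congN u v : pres_cong rel u v -> N ((ev u)^-1 * ev v).
  rewrite /ev; elim=> {u v} [u|u v _|u v w _ uv _ vw|u u' v v' _ uu _ vv|a|//].
  - by rewrite mulVg.
  - by move/NV; rewrite invgM invgK.
  - by have := NM _ _ uv vw; rewrite -!mulgA mulVKg.
  - rewrite !eval_word_cat invgM.
    (* On values, (uv)^-1 u'v' = (u^-1 u')^v (v^-1 v'). *)
    have := NM _ _ (NJ _ (eval_word id v) uu) vv.
    by rewrite /conjg -!mulgA mulVKg.
  - by rewrite eval_word_cancel mulg1 invg1.
pose f (g : G) : presented_group rel := gen rel g.
have fM : {morph f : g h / g * h}.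
  move=> g h; rewrite /f /gen -pi_cat; apply/presented_eqP; apply: cong_rel.
  by rewrite /rel /ev /= !mulg1 mulVg.
have f1 : f 1 = 1.
  by apply/presented_eqP; apply: cong_rel; rewrite /rel /ev /= !mulg1 invg1.
pose m1 := isMultiplicative.Build G (presented_group rel) f fM.
pose m2 := Multiplicative_isUMagmaMorphism.Build G (presented_group rel) f f1.
pose f' : UMagmaMorphism.type G (presented_group rel) := HB.pack f m1 m2.
exists (presented_group rel), f' => x; split=> [/presented_eqP/congN|Nx].
  by rewrite /ev /= !mulg1 => /NV; rewrite invgK.
by apply/presented_eqP; apply: cong_rel; rewrite /rel /ev /= !mulg1; apply: NV.
Qed.

Lemma ker_subgroup (G Q : groupType) (f : UMagmaMorphism.type G Q) :
  is_subgroup [set x | f x = 1].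
Proof.
split=> [|x y /= fx fy|x /= fx]; first exact: gmulf1.
  by rewrite gmulfM fx fy mulg1.
by rewrite gmulfV fx invg1.
Qed.

Lemma morph_eqP (G Q : groupType) (f : UMagmaMorphism.type G Q) (x y : G) :
  f x = f y <-> f (x^-1 * y) = 1.
Proof.
rewrite gmulfM gmulfV; split=> [->|]; first by rewrite mulVg.
by move/mulg1_eq; rewrite invgK.
Qed.

Lemma commute_generated (G Q : groupType) (f : UMagmaMorphism.type G Q) (S : set G) :
    generated S = [set: G] ->
    (forall x y, S x -> S y -> commute (f x) (f y)) ->
  forall x y, commute (f x) (f y).
Proof.
move=> genS Sf x y.
have centralizer (z : Q) : is_subgroup [set g | commute z (f g)].
  split=> /= [|u v zu zv|u zu]; first by rewrite gmulf1; apply: commute1.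
    by rewrite gmulfM; apply: commuteM.
  by rewrite gmulfV; apply: commuteV.
have extend z : (forall s, S s -> commute z (f s)) -> forall g, commute z (f g).
  move=> zS g; suff /(_ g) : [set: G] `<=` [set h | commute z (f h)] by apply.
  by rewrite -genS; apply: generated_min.
by apply: (extend) => s Ss; apply/commute_sym/extend => s' Ss'; apply: Sf.
Qed.

(** * Consequences of the singular braid relations *)

Section SingularBraids.
Variable n : nat.
Implicit Types (i j k : 'I_n.-1) (c d : bool).

(* [braid_gen false i] is [sigma_(i+1)] and [braid_gen true i] is [rho_(i+1)]. *)
Definition braid_gen c i : SG n := gen _ (if c then inr i else inl i).

Lemma generated_braid_gen :
  generated [set braid_gen p.1 p.2 | p in [set: bool * 'I_n.-1]] = [set: SG n].
Proof.
rewrite -[RHS]generated_gen; congr generated; apply/seteqP.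
split=> g [] => [[c i]|[i|i]] _ <- /=; first by exists (if c then inr i else inl i).
  by exists (false, i).
by exists (true, i).
Qed.

Lemma braid_gen_commute c d i j :
  (i == j) || far i j -> commute (braid_gen c i) (braid_gen d j).
Proof.
have farC k l : far k l = far l k by rewrite /far orbC.
have rel_commute x y : SG_rel [:: (x, false); (y, false)] [:: (y, false); (x, false)] ->
    commute (gen (@SG_rel n) x) (gen (@SG_rel n) y).
  by move=> /cong_rel/presented_eqP; rewrite -!(cat1s _ [:: _]) !pi_cat.
have sr k l : (k == l) || far k l -> commute (braid_gen false k) (braid_gen true l).
  by move=> kl; apply: rel_commute; apply: SG_mixed_comm.
move=> ij; case: c d => [] []; last 1 first.
- move: ij; have [<- _|_ /= ij] := eqVneq i j; first exact: commute_refl.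
  by apply: rel_commute; apply: SG_sigma_far.
- move: ij; have [<- _|_ /= ij] := eqVneq i j; first exact: commute_refl.
  by apply: rel_commute; apply: SG_rho_far.
- by apply/commute_sym/sr; rewrite eq_sym farC.
- exact: sr.
Qed.

Lemma sigma_braid i j : j = i.+1 :> nat ->
  braid_gen false i * braid_gen false j * braid_gen false i
  = braid_gen false j * braid_gen false i * braid_gen false j.
Proof.
by move=> /SG_sigma_braid/cong_rel/presented_eqP; rewrite -!mulgA !pi_cat.
Qed.

Lemma rho_conj i j : j = i.+1 :> nat ->
  braid_gen true i * (braid_gen false j * braid_gen false i)
  = braid_gen false j * braid_gen false i * braid_gen true j.
Proof.
by move=> /SG_mixed_braid1/cong_rel/presented_eqP; rewrite -!mulgA !pi_cat.
Qed.

Lemma commutative_image (Q : groupType) (f : UMagmaMorphism.type (SG n) Q) :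
    (forall p q : bool * 'I_n.-1,
      commute (f (braid_gen p.1 p.2)) (f (braid_gen q.1 q.2))) ->
  forall x y, commute (f x) (f y).
Proof.
move=> fC; apply: (commute_generated generated_braid_gen).
by move=> _ _ [p _ <-] [q _ <-].
Qed.

(** Modulo [H] each kind of generator has a single image. The two images commute because [sigma_i]
    and [rho_i] do, so the quotient is abelian. *)
Lemma commutator_subgroup_SG_min (H : set (SG n)) : is_normal H ->
    (forall c i j, H ((braid_gen c i)^-1 * braid_gen c j)) ->
  SG' n `<=` H.
Proof.
move=> nH HD; have [Q [f fH]] := quotient_exists nH.
have feq c i j : f (braid_gen c i) = f (braid_gen c j).
  by apply/morph_eqP/fH; apply: HD.
apply: commutator_subgroup_min => [|x y _ _]; first by case: nH.
apply/fH; rewrite gmulfR; apply/eqP/commgP; apply: commutative_image => p q.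
by rewrite (feq q.1 q.2 p.2); apply/gmulf_commute/braid_gen_commute; rewrite eqxx.
Qed.

Lemma braid_eq (T : groupType) (x y : T) : commute x y -> x * y * x = y * x * y -> x = y.
Proof. by move=> xy; rewrite xy => /mulgI. Qed.

(* If all the images of the [sigma_i] agree then the relation between
   [rho_i] and [rho_(i+1)] becomes conjugation by an element that commutes
   with [rho_i]. *)
Lemma braid_gen_collapse (Q : groupType) (f : UMagmaMorphism.type (SG n) Q) :
    (forall i j, j = i.+1 :> nat ->
      commute (f (braid_gen false i)) (f (braid_gen false j))) ->
  forall c i j, f (braid_gen c i) = f (braid_gen c j).
Proof.
move=> fC.
suff succ c i j : j = i.+1 :> nat -> f (braid_gen c i) = f (braid_gen c j).
  move=> c; suff le (e : nat) : forall i j, j = i + e :> nat ->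
      f (braid_gen c i) = f (braid_gen c j).
    move=> i j; have [ij|/ltnW ji] := leqP i j.
      by apply: (le (j - i)%N); rewrite subnKC.
    by symmetry; apply: (le (i - j)%N); rewrite subnKC.
  elim: e => [|e IH] i j; first by rewrite addn0 => /val_inj ->.
  move=> jE; have en : i + e < n.-1 by rewrite (leq_trans _ (ltn_ord j))// jE addnS.
  by rewrite (IH i (Ordinal en)) //; apply: succ; rewrite jE addnS.
have sigma_eq (k l : 'I_n.-1) : l = k.+1 :> nat -> f (braid_gen false k) = f (braid_gen false l).
  by move=> kl; apply: braid_eq; [exact: fC | rewrite -!gmulfM sigma_braid].
move=> ij; case: c; last exact: sigma_eq.
have rs : commute (f (braid_gen true i)) (f (braid_gen false i)).
  by apply/gmulf_commute/braid_gen_commute; rewrite eqxx.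
have := congr1 f (rho_conj ij); rewrite !gmulfM -(sigma_eq _ _ ij).
by rewrite (commuteM rs rs) => /mulgI.
Qed.

(** In the abelianization the braid relations identify all generators of one kind. *)
Lemma diff_SG' c i j : SG' n ((braid_gen c i)^-1 * braid_gen c j).
Proof.
have nT : is_normal [set: SG n] by [].
have [Q [f fH]] := quotient_exists (commutator_subgroup_normal nT).
apply/fH/morph_eqP; apply: braid_gen_collapse => k l _.
by apply/commgP/eqP; rewrite -gmulfR; apply/fH; apply: mem_commutator.
Qed.

Lemma SG'_normal : is_normal (SG' n).
Proof. by apply: commutator_subgroup_normal. Qed.

End SingularBraids.

(** * At least five strands: generating set and perfectness *)

Section FiveStrands.
Variable m : nat.
Local Notation n := m.+4.+1.

Local Definition idx0 : 'I_n.-1 := ord0.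
(** The index of [sigma_4], far from both 0 and 1; it exists because n >= 5. *)
Local Definition idx3 : 'I_n.-1 := @Ordinal m.+4 3 isT.

Definition SG'_gen (p : bool * 'I_m.+3) : SG n :=
  (braid_gen p.1 idx0)^-1 * braid_gen p.1 (lift ord0 p.2 : 'I_n.-1).

Local Notation H := (generated (range SG'_gen)).

Lemma far0 (i : 'I_n.-1) : 1 < i -> far idx0 i.
Proof. by move=> ?; apply/orP; left. Qed.

Lemma div_generated (c : bool) (i j : 'I_n.-1) : H ((braid_gen c i)^-1 * braid_gen c j).
Proof.
have [H1 HM HV] := generated_subgroup (range SG'_gen).
have H0 k : H ((braid_gen c idx0)^-1 * braid_gen c k).
  case: (unliftP (idx0 : 'I_m.+4) k) => [l ->|->]; last by rewrite mulVg.
  by apply: sub_gen_smallest; exists (c, l).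
by have := HM _ _ (HV _ (H0 i)) (H0 j); rewrite invgM invgK mulgA mulgK.
Qed.

(* The elements [(g_0)^-1 g_j] and [g_j (g_0)^-1] agree, except for
   [j = 1], which goes through the index 3 instead. *)
Lemma divr_generated (c : bool) (i j : 'I_n.-1) : H (braid_gen c i * (braid_gen c j)^-1).
Proof.
have [H1 HM HV] := generated_subgroup (range SG'_gen).
have Hfar k l : far k l -> H (braid_gen c k * (braid_gen c l)^-1).
  move=> kl; have -> : commute (braid_gen c k) (braid_gen c l)^-1.
    by apply/commuteV/braid_gen_commute; rewrite kl orbT.
  exact: div_generated.
have H0 k : H (braid_gen c k * (braid_gen c idx0)^-1).
  have [k1|k1] := ltnP 1 k; first by apply: Hfar; rewrite /far orbC; exact: far0.
  have := HM _ _ (Hfar k idx3 _) (Hfar idx3 idx0 isT); rewrite mulgA mulgVK; apply.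
  by rewrite /far /= !ltnS k1.
by have := HM _ _ (H0 i) (HV _ (H0 j)); rewrite invgM invgK mulgA mulgVK.
Qed.

(* Every generator of [H] commutes with [g_0] or with [g_3], and all the [g_i]
   lie in the same left, and in the same right, coset of [H]. *)
Lemma H_normal : is_normal H.
Proof.
have [H1 HM HV] := generated_subgroup (range SG'_gen).
apply: (generated_normal (@generated_braid_gen n)) => _ _ [[d j] _ <-] [[c i] _ <-] /=.
set x := SG'_gen _.
have Hx : H x by apply: sub_gen_smallest; exists (c, i).
have HJ h : H h -> H (x ^ h) by move=> Hh; apply: HM (HV _ Hh) (HM _ _ Hx Hh).
have [k xk] : exists k, commute x (braid_gen d k).
  have comm k : (k == idx0) || far k idx0 ->
      (k == lift ord0 i) || far k (lift ord0 i) -> commute x (braid_gen d k).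
    by move=> k0 ki; apply/commute_sym/commuteM;
      [apply/commuteV|]; apply: braid_gen_commute.
  (* The element [x] involves the indices 0 and i + 1: index 0 works if i + 1 >= 2, and index 3 if i
     + 1 = 1. *)
  have [i1|i1] := ltnP 0 i; [exists idx0 | exists idx3]; apply: comm => //.
    by apply/orP; right; apply: far0.
  by have -> : i = ord0 by apply: val_inj; apply/eqP; rewrite -leqn0.
have xJ : x ^ braid_gen d k = x by apply/conjg_fixP/commgP.
split.
  by rewrite -(mulVKg (braid_gen d k) (braid_gen d j)) conjgM xJ; apply: HJ; apply: div_generated.
(* The first factor fixes [x]; the second lies in [H] by the right coset property. *)
have -> : (braid_gen d j)^-1 = (braid_gen d k)^-1 * (braid_gen d k * (braid_gen d j)^-1).
  by rewrite mulKg.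
by rewrite conjgM -{1}xJ conjgK; apply: HJ; apply: divr_generated.
Qed.

Lemma generated_SG' : H = SG' n.
Proof.
apply/seteqP; split.
  apply: generated_min; first by case: (SG'_normal n).
  by move=> _ [p _ <-]; apply: diff_SG'.
exact: commutator_subgroup_SG_min H_normal div_generated.
Qed.

(** By [commutator_subgroup_SG_min] it is enough that the generators of each kind coincide modulo
    the second derived subgroup. *)
Lemma perfect_SG' : perfect (SG' n).
Proof.
have [sG' nG'] := SG'_normal n.
apply/seteqP; split; last exact: commutator_subgroup_sub.
have nG'' := commutator_subgroup_normal (SG'_normal n).
apply: commutator_subgroup_SG_min => // c i j.
have [Q [f fN]] := quotient_exists nG''.
have fC x y : SG' n x -> SG' n y -> commute (f x) (f y).
  by move=> *; apply/commgP/eqP; rewrite -gmulfR; apply/fN; apply: mem_commutator.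
apply/fN/morph_eqP; apply: braid_gen_collapse => {c i j} i j ij.
pose s k := f (braid_gen false k).
have sfar k l : far k l -> commute (s k) (s l).
  by move=> kl; apply/gmulf_commute/braid_gen_commute; rewrite kl orbT.
have s01 : commute (s idx0) (s (lift ord0 ord0 : 'I_m.+4)).
  set i1 := lift _ _.
  have := fC _ _ (diff_SG' false idx3 idx0) (diff_SG' false idx3 i1).
  (* As [s idx3] commutes with both, its inverses move to the left and cancel. *)
  have [c0 c1] := (commuteV (sfar idx0 idx3 isT), commuteV (sfar i1 idx3 isT)).
  rewrite !gmulfM !gmulfV -/(s _) -/(s _) -/(s _) /commute.
  rewrite -!mulgA (mulgA (s idx0)) c0 (mulgA (s i1)) c1 -!mulgA.
  by move=> /mulgI/mulgI.
(* Once the images at k and k + 1 commute they are equal, and index k is far from k + 2. *)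
case: i j ij => [k kn] j; elim: k kn j => [|k IH] kn j jE.
  have -> : j = lift ord0 ord0 by apply: val_inj; rewrite /= jE.
  by have -> : Ordinal kn = idx0 by apply: val_inj.
have kn' := ltnW kn.
have eqs : s (Ordinal kn') = s (Ordinal kn).
  by apply: braid_eq; [exact: IH | rewrite /s -!gmulfM sigma_braid].
by rewrite -/(s _) -eqs; apply: sfar; rewrite /far /= jE /= ltnSn.
Qed.

End FiveStrands.

(** * Affine maps of sequences over the field with three elements *)

(* [(b, k, f)] stands for the map [x |-> (-1)^b * shift^k x + f] of the module of
   sequences [int -> 'F_3], and the product is composition. *)
Definition affine : Type := bool * int * (int -> 'F_3).

HB.instance Definition _ := Choice.on affine.

Section Affine.
Local Open Scope ring_scope.
Import GRing.Theory.

Definition sgn3 (b : bool) (x : 'F_3) : 'F_3 := if b then - x else x.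

Lemma F3_triple (x : 'F_3) : x + x + x = 0.
Proof. by case: x => [] [|[|[|]]] // ?; apply: val_inj. Qed.

Definition affine_one : affine := (false, 0, fun=> 0).
Definition affine_mul (u v : affine) : affine :=
  (u.1.1 (+) v.1.1, u.1.2 + v.1.2, fun i => u.2 i + sgn3 u.1.1 (v.2 (i - u.1.2))).
Definition affine_inv (u : affine) : affine :=
  (u.1.1, - u.1.2, fun i => - sgn3 u.1.1 (u.2 (i + u.1.2))).

Lemma affine_eq (b b' : bool) (k k' : int) (f f' : int -> 'F_3) :
  b = b' -> k = k' -> f =1 f' -> (b, k, f) = (b', k', f') :> affine.
Proof. by move=> -> -> /funext ->. Qed.

Lemma affine_mulA : associative affine_mul.
Proof.
move=> [[b k] f] [[c l] g] [[d m] h]; apply: affine_eq => /=.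
- by rewrite addbA.
- by rewrite addrA.
move=> i; rewrite opprD addrA; case: b c => [] [] /=; ring.
Qed.

Lemma affine_mul1g : left_id affine_one affine_mul.
Proof. by move=> [[b k] f]; apply: affine_eq => //= [|i]; rewrite ?add0r ?subr0. Qed.

Lemma affine_mulg1 : right_id affine_one affine_mul.
Proof.
move=> [[b k] f]; apply: affine_eq => //= [||i]; rewrite ?addr0 ?addbF //.
by case: b; rewrite /= ?oppr0 addr0.
Qed.

Lemma affine_mulVg : left_inverse affine_one affine_inv affine_mul.
Proof.
move=> [[b k] f]; apply: affine_eq => //= [||i]; rewrite ?addbb ?addNr //.
by rewrite opprK addNr.
Qed.

Lemma affine_mulgV : right_inverse affine_one affine_inv affine_mul.
Proof.
move=> [[b k] f]; apply: affine_eq => //= [||i]; rewrite ?addbb ?subrr //.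
by rewrite subrK; case: b => /=; rewrite ?opprK ?subrr ?addNr.
Qed.

HB.instance Definition _ := isGroup.Build affine
  affine_mulA affine_mul1g affine_mulg1 affine_mulVg affine_mulgV.

Definition delta (i : int) : 'F_3 := if i == 0%R then 1%R else 0%R.

Definition center (b : bool) (i : int) : 'F_3 := if b then delta i else 0%R.

(* The affine maps with linear parts [-1] and [shift] that fix [center b]; note
   that [2 = -1] in ['F_3]. *)
Definition reflection (b : bool) : affine := (true, 0, fun i => - center b i).
Definition dilation (b : bool) : affine :=
  (false, 1, fun i => center b i - center b (i - 1)).

End Affine.

Lemma affineM (u v : affine) : u * v = affine_mul u v. Proof. by []. Qed.

Lemma affineV (u : affine) : u^-1 = affine_inv u. Proof. by []. Qed.

(** The translation parts differ by 3 ([center c] - [center b]), which vanishes modulo 3. *)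
Lemma reflection_braid b c :
  reflection b * reflection c * reflection b = reflection c * reflection b * reflection c.
Proof.
rewrite !affineM; apply: affine_eq => // i /=.
rewrite !GRing.subr0; apply/eqP; rewrite -GRing.subr_eq0.
rewrite -(F3_triple (center c i - center b i)%R); apply/eqP; ring.
Qed.

(** The product of the two reflections is the translation taking [center c] to [center b], so it
    conjugates one dilation into the other. *)
Lemma dilation_conj b c : dilation b * (reflection c * reflection b)
  = reflection c * (reflection b * dilation c).
Proof.
rewrite !affineM; apply: affine_eq => // i /=; rewrite !GRing.subr0; ring.
Qed.

Lemma dilation_reflection b : reflection b * dilation b = dilation b * reflection b.
Proof.
rewrite !affineM; apply: affine_eq => // i /=; rewrite !GRing.subr0.
apply/eqP; rewrite -GRing.subr_eq0.
rewrite -(F3_triple (center b (i - 1) - center b i)%R); apply/eqP; ring.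
Qed.

Lemma dilation_expn k : dilation false ^+ k = (false, Posz k, fun=> 0%R) :> affine.
Proof.
elim: k => [//|k IH]; rewrite expgS IH affineM; apply: affine_eq => [//|/=|i /=]; first by lia.
by rewrite !GRing.subr0 GRing.addr0.
Qed.

(** The product of reflections is translation by -[delta]; conjugating its inverse by
    [dilation false ^+ k], a pure shift, moves the support to k. *)
Lemma shift_translation k (i : int) :
  ([~ dilation false ^- k, reflection true * (reflection false)^-1] : affine).2 i
  = (delta (i - Posz k) - delta i)%R.
Proof.
rewrite dilation_expn /commg /conjg !affineM !affineV /= /center.
rewrite !(GRing.opprK, GRing.subr0, GRing.addr0, GRing.oppr0, GRing.add0r).
by rewrite GRing.subrK.
Qed.

Lemma card_setT_le (T : finType) : [set: T] #<= `I_#|T|.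
Proof.
have -> : [set: T] = enum_val @` [set: 'I_#|T|].
  by apply/seteqP; split=> // x _; exists (enum_rank x); rewrite ?enum_rankK.
by rewrite (card_le_eqr card_II); exact: card_image_le.
Qed.

(** * Three and four strands: the affine representation *)

Section FewStrands.
Variable m : nat.
Hypothesis m2 : m < 2.
Local Notation n := m.+3.

(** With at most three indices, far indices have the same parity, hence the same center, and
    commutation survives. The braid relations hold for any two centers. *)
Lemma SG_affine : exists phi : UMagmaMorphism.type (SG n) affine,
  forall c (i : 'I_n.-1),
    phi (braid_gen c i) = if c then dilation (odd i) else reflection (odd i).
Proof.
have odd_far (i j : 'I_n.-1) : far i j -> odd i = odd j.
  move: i j m2 => [i iP] [j jP]; rewrite /far /= in iP jP *.
  by case: m iP jP => [|[|//]]; case: i => [|[|[|]]]; case: j => [|[|[|]]].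
pose f (x : SG_gen n) := match x with
  | inl i => reflection (odd i) | inr i => dilation (odd i) end.
have [u v|phi phiE] := @presented_lift _ (@SG_rel n) affine f.
  case=> {u v} i j ij; rewrite /= ?mulg1 /=.
  - by rewrite (odd_far i j ij).
  - by rewrite !mulgA; apply: reflection_braid.
  - by rewrite (odd_far i j ij).
  - exact: dilation_conj.
  - exact: dilation_conj.
  - have -> : odd i = odd j by case/orP: ij => [/eqP->|/odd_far].
    exact: dilation_reflection.
by exists phi => c i; rewrite /braid_gen phiE; case: c.
Qed.

(** Linear parts multiply in an abelian group, so those of commutators are trivial. *)
Lemma SG'_translation (phi : UMagmaMorphism.type (SG n) affine) x :
  SG' n x -> (phi x).1 = (false, 0%R).
Proof.
move: x; apply: commutator_subgroup_min => [|x y _ _] /=.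
  split=> /= [|x y|x]; first by rewrite gmulf1.
    by rewrite gmulfM affineM /affine_mul /= => -> ->.
  by rewrite gmulfV affineV /affine_inv /= => ->; rewrite GRing.oppr0.
rewrite gmulfR /commg /conjg !affineM !affineV /=.
congr (_, _); first by case: (phi x).1.1; case: (phi y).1.1.
by lia.
Qed.

Lemma unbounded_translation : exists phi : UMagmaMorphism.type (SG n) affine,
  (forall x, exists N : nat, forall i : int, (N%:Z <= i)%R -> (phi x).2 i = 0%R) /\
  (forall N : nat, exists2 x, SG' n x & (phi x).2 (Posz N.+1) <> 0%R).
Proof.
have [phi phiE] := SG_affine; exists phi; split=> [x|N].
  suff : [set: SG n] `<=` [set x | exists N : nat, forall i : int,
    (N%:Z <= i)%R -> (phi x).2 i = 0%R] by apply.
  rewrite -generated_braid_gen; apply: generated_min.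
    split=> /= [|{}x y [M xM] [N yN]|{}x [M xM]].
    - by exists 0 => i _; rewrite gmulf1.
    - exists (M + N + `|(phi x).1.2|%N) => i iMN; rewrite gmulfM affineM /=.
      rewrite xM ?yN; [|lia|lia]; rewrite GRing.add0r /sgn3.
      by case: ifP; rewrite ?GRing.oppr0.
    - exists (M + `|(phi x).1.2|%N) => i iM; rewrite gmulfV affineV /=.
      rewrite xM; last by move: (phi x).1.2 iM => k iM; lia.
      by rewrite /sgn3; case: ifP; rewrite ?GRing.oppr0.
  (* Translation parts of generators are supported in {0, 1}. *)
  move=> _ [[c i] _ <-]; exists 2 => j j2; rewrite /= phiE.
  have d0 k : (1 <= k)%R -> delta k = 0%R by rewrite /delta; case: eqP => // ->.
  by case: c => /=; rewrite /center; case: ifP; rewrite ?d0 ?GRing.subr0 ?GRing.oppr0 //; lia.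
pose i0 : 'I_n.-1 := ord0; pose i1 : 'I_n.-1 := @Ordinal m.+2 1 isT.
exists [~ (braid_gen true i0) ^- N.+1, braid_gen false i1 * (braid_gen false i0)^-1].
  by apply: mem_commutator.
rewrite gmulfR gmulfV gmulfXn gmulfM gmulfV !phiE shift_translation.
by rewrite GRing.subrr => /eqP.
Qed.

(* Any finite set of elements of [SG'] has a common right bound for the supports of the
   translations, and this bound is a subgroup condition. *)
Lemma SG'_not_fg : ~ finitely_generated (SG' n).
Proof.
move=> [A /finite_seqP[s ->] As].
have [phi [bounded unbounded]] := unbounded_translation.
have As' : [set` s] `<=` SG' n by rewrite -As; apply: sub_gen_smallest.
have [N sN] : exists N : nat, forall x, x \in s ->
    forall i : int, (Posz N <= i)%R -> (phi x).2 i = 0%R.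
  elim: s {As As'} => [|x s [N sN]]; first by exists 0.
  have [M xM] := bounded x; exists (M + N) => y.
  rewrite inE => /predU1P[->|ys] i iMN; first by apply: xM; lia.
  by apply: sN ys _ _; lia.
have [x] := unbounded N; rewrite -As => Ax; case.
(* The trivial linear part is kept in [K], so that products do not shift supports beyond N. *)
pose K := [set x | (phi x).1 = (false, 0%R) /\
  forall i : int, (Posz N <= i)%R -> (phi x).2 i = 0%R].
suff /(_ x Ax)[_] : generated [set` s] `<=` K
  by move=> xN; apply: xN; lia.
apply: generated_min => [|y ys]; last first.
  by split; [apply: SG'_translation; exact: As' | exact: sN _ ys].
split=> [|y z [y1 yN] [z1 zN]|y [y1 yN]]; rewrite /K /=.
- by rewrite gmulf1.
- rewrite gmulfM affineM /affine_mul /= y1 z1; split=> // i iN.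
  by rewrite GRing.subr0 yN // zN //= GRing.addr0.
- rewrite gmulfV affineV /affine_inv /= y1; split=> /= [|i iN].
    by rewrite GRing.oppr0.
  by rewrite GRing.addr0 yN // GRing.oppr0.
Qed.

(** Translations commute, so [phi] kills the second derived subgroup, but not [SG' n]. *)
Lemma SG'_not_perfect : ~ perfect (SG' n).
Proof.
have [phi [_ unbounded]] := unbounded_translation.
move=> SG''; have [x] := unbounded 0; rewrite SG'' => SGx; case.
suff /(_ x SGx) /= -> : commutator_subgroup (SG' n) `<=` [set y | phi y = 1] by [].
apply: commutator_subgroup_min; first exact: ker_subgroup.
move=> y z /(SG'_translation phi) y1 /(SG'_translation phi) z1 /=.
rewrite gmulfR; apply/eqP/commgP; rewrite /commute !affineM /affine_mul y1 z1 /=.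
by apply: affine_eq => // i; rewrite !GRing.subr0 GRing.addrC.
Qed.

End FewStrands.

Local Close Scope group_scope.

Theorem theorem1p1 :
  [/\ forall n : nat, 5 <= n ->
        finitely_generated (SG' n) /\
        exists2 r : nat, has_rank (SG' n) r & r <= 2 * n - 4,
      ~ finitely_generated (SG' 3) /\ ~ finitely_generated (SG' 4)
    & forall n : nat, 3 <= n -> (perfect (SG' n) <-> 5 <= n)].
Proof.
split.
- case=> [|[|[|[|[|m]]]]] // _.
  (* There are 2(m + 3) = 2n - 4 indices, where n = m + 5. *)
  have Ak : range (@SG'_gen m) #<= `I_(2 * m.+4.+1 - 4).
    apply: card_le_trans (card_image_le _ _) _; apply: card_le_trans (card_setT_le _) _.
    by rewrite card_le_II card_prod card_bool card_ord; lia.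
  split; last exact: has_rank_le Ak (generated_SG' m).
  exists (range (@SG'_gen m)); last exact: generated_SG'.
  by apply/finite_set_leP; eexists; exact: Ak.
- by split; apply: SG'_not_fg.
- case=> [|[|[|[|[|m]]]]] // _; split=> //; try by move/SG'_not_perfect; case.
  by move=> _; apply: perfect_SG'.
Qed.
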